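(* Let $C$ be a closed connected set in $\mathbb{R}^3$ whose complement $\Omega=\mathbb{R}^3\setminus C$ has the property that for every point $p\in\Omega$ there is an affine $2$-plane $\Lambda\subset\mathbb{R}^3$ with $p\in\Lambda$ satisfying the following two conditions: (a) there is a number $\delta>0$ such that the Euclidean $\delta$-tube $\{x\in\mathbb{R}^3:\mathrm{dist}(x,\Lambda)<\delta\}$ around $\Lambda$ is contained in $\Omega$, and (b) given any ball $B\subset\mathbb{R}^3$ centred at $0$ there is a point $q\in\Lambda$ such that $q+B\subset\Omega$. Then $C$ is convex. *)

(* Defs.v *)
From mathcomp Require Export all_boot all_order all_algebra.
From mathcomp Require Export all_classical all_reals all_analysis.

Export Order.TTheory GRing.Theory Num.Theory.
Export numFieldNormedType.Exports.

Set Implicit Arguments.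
Unset Strict Implicit.
Unset Printing Implicit Defensive.

Local Open Scope classical_set_scope.
Local Open Scope ring_scope.

(* The library's norm on row vectors is the sup norm. It induces the usual
   topology, so [closed] and [connected] are used as they are, but distances
   and balls need the Euclidean norm. *)
Definition enorm (R : realType) (n : nat) (x : 'rV[R]_n) : R :=
  Num.sqrt (\sum_(i < n) x ord0 i ^+ 2).

(* [inf set0] is 0; this is only used for nonempty A. *)
Definition edist_set (R : realType) (n : nat) (x : 'rV[R]_n)
    (A : set 'rV[R]_n) : R :=
  inf [set enorm (x - y) | y in A].

Definition tube (R : realType) (n : nat) (A : set 'rV[R]_n) (d : R) :
    set 'rV[R]_n :=
  [set x | edist_set x A < d].

(* The plane through a whose direction is the row space of U. *)
Definition affine_plane (R : realType) (n : nat) (L : set 'rV[R]_n) : Prop :=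
  exists (a : 'rV[R]_n) (U : 'M[R]_n),
    \rank U = 2%N /\ L = [set x | (x - a <= U)%MS].

(* Main.v *)
Require Import Defs.

(** A connected set cannot cross a plane that it misses. Suppose that two
   points x and y of C had a point p outside C on the segment joining
   them, and let L be the plane through p given by the hypothesis. The tube
   around L contains L, so L misses C ([sub_tube]). Being of codimension one,
   L is a level set of a linear form g ([affine_plane_level]), and g p
   is a convex combination of g x and g y. As C is connected and g is
   continuous, g maps C onto an interval, so g takes the value g p somewhere
   on C ([connected_linear_form_itv]): C meets L, a contradiction. *)

Local Open Scope classical_set_scope.
Local Open Scope ring_scope.

Lemma enorm_ge0 {R : realType} {n : nat} (x : 'rV[R]_n) : 0 <= enorm x.
Proof. exact: sqrtr_ge0. Qed.

Lemma enorm0 (R : realType) (n : nat) : enorm (0 : 'rV[R]_n) = 0.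
Proof.
by rewrite /enorm big1 ?sqrtr0 // => i _; rewrite mxE expr0n.
Qed.

Lemma sub_tube {R : realType} {n : nat} (A : set 'rV[R]_n) (d : R) :
  0 < d -> A `<=` tube A d.
Proof.
move=> d_gt0 x Ax; rewrite /tube /= (le_lt_trans _ d_gt0) //.
apply: ge_inf; last by exists x; rewrite // subrr enorm0.
by exists 0 => _ [y _ <-]; exact: enorm_ge0.
Qed.

(** The annihilator of a hyperplane is a line: the cokernel of U has rank one,
   so all its columns are proportional to one vector, which defines the same
   kernel. *)
Lemma submx_codim1 {F : fieldType} {n : nat} {U : 'M[F]_n.+1} :
  \rank U = n ->
  exists v : 'cV[F]_n.+1, forall x : 'rV[F]_n.+1, (x <= U)%MS = (x *m v == 0).
Proof.
move=> rkU.
have rk1 : \rank (cokermx U) = 1%N by rewrite mxrank_coker rkU subSnn.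
have [v vE] : exists v : 'M[F]_(n.+1, \rank (cokermx U)),
    forall x : 'rV[F]_n.+1, (x <= U)%MS = (x *m v == 0).
  exists (col_base (cokermx U)) => x.
  rewrite submxE -{1}(mulmx_base (cokermx U)) mulmxA.
  by rewrite mulmx_free_eq0 ?row_base_free.
(* The vector's width is the rank; only now is it rewritten to 1, since
   [col_base] and [row_base] have the rank in their types. *)
by move: v vE; rewrite rk1 => v vE; exists v.
Qed.

Lemma affine_plane_level {R : realType} {L : set 'rV[R]_3} :
  affine_plane L ->
  exists (v : 'cV[R]_3) (c : R), L = [set x | (x *m v) ord0 ord0 = c].
Proof.
move=> [a [U [rkU ->]]]; have [v vE] := submx_codim1 rkU.
exists v, ((a *m v) ord0 ord0); apply/seteqP; split => x /=.
  by rewrite vE mulmxBl subr_eq0 => /eqP ->.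
move=> xa; rewrite vE mulmxBl subr_eq0; apply/eqP/matrixP => i j.
by rewrite !ord1.
Qed.

Lemma continuous_linear_form {R : realType} {n : nat} (v : 'cV[R]_n) :
  continuous (fun x : 'rV[R]_n => (x *m v) ord0 ord0).
Proof.
under eq_fun do rewrite mxE.
apply: continuous_big => [|i _ x]; first exact: add_continuous.
apply: (@continuous_comp _ _ _
  (fun y : 'rV[R]_n => y ord0 i) ( *%R^~ (v i ord0))).
  exact: coord_continuous.
exact: mulrr_continuous.
Qed.

(** The intermediate value theorem: this is where connectedness prevents a set
   from having points strictly on both sides of a plane that it misses. *)
Lemma connected_linear_form_itv {R : realType} {n : nat} {C : set 'rV[R]_n}
    (v : 'cV[R]_n) :
  connected C -> is_interval [set (x *m v) ord0 ord0 | x in C].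
Proof.
move=> C_conn; apply/connected_intervalP.
apply: connected_continuous_connected => //.
exact/continuous_subspaceT/continuous_linear_form.
Qed.

Lemma is_interval_convex {R : realType} (I : set R) :
  is_interval I -> @convex_set R R^o I.
Proof.
move=> I_itv x y t /set_mem Ix /set_mem Iy; apply/mem_set.
wlog le_xy : x y t Ix Iy / x <= y.
  move=> H; have [le_xy|/ltW le_yx] := leP (x : R) y; first exact: H.
  by rewrite convC; exact: H.
by apply: (I_itv x y) => //; have := convR_itv t le_xy; rewrite in_itv.
Qed.

Theorem corollary1p6 (R : realType) (C : set 'rV[R]_3)
    (C_closed : closed C) (C_connected : connected C)
    (C_planes : forall p : 'rV[R]_3, (~` C) p ->
      exists L : set 'rV[R]_3,
        [/\ affine_plane L, L p,
            exists2 d : R, 0 < d & tube L d `<=` ~` C &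
            forall r : R, 0 < r -> exists2 q : 'rV[R]_3, L q &
              [set q + b | b in ball_ (@enorm R 3) 0 r] `<=` ~` C]) :
  convex_set C.
Proof.
move=> x y t /set_mem Cx /set_mem Cy; apply/mem_set.
set p := conv _ _ _; apply: contrapT => nCp.
have [L [/affine_plane_level[v [c Lvc]] Lp [d d_gt0 tubeC] _]] := C_planes _ nCp.
pose g (x : 'rV[R]_3) := (x *m v) ord0 ord0.
have gp : g p = @conv R R^o t (g x) (g y).
  by rewrite /g mulmxDl -!scalemxAl !mxE.
have [z Cz gz] : [set g z | z in C] (g p).
  rewrite gp; apply/set_mem.
  apply: is_interval_convex; first exact: connected_linear_form_itv.
    by apply/mem_set; exists x.
  by apply/mem_set; exists y.
have gpc : g p = c by move: Lp; rewrite Lvc.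
apply: (tubeC z) => //; apply: sub_tube d_gt0 _ _.
by rewrite Lvc /= -gpc -gz.
Qed.
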